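(* Let $k \geq 2$ and $0 \leq j \leq k-1$ be integers. The Fibonacci sequence $B^{(j)}$ of order $k$ satisfies $$B_n^{(j)} = - \sum_{i \in \mathbb{Z}} (-1)^i \left\langle \binom{n-ik}{i-1} \right\rangle 2^{n+1-i(k+1)} + \sum_{i \in \mathbb{Z}} (-1)^i \left\langle \binom{n-j-1-ik}{i-1} \right\rangle 2^{n-j-i(k+1)} \quad \text{for all } n \in \mathbb{Z}.$$
   Context: Fix an integer $k \geq 2$. A two-sided sequence $\{F_n\}_{n\in\mathbb{Z}}$ is a Fibonacci sequence of order $k$ if $F_n = F_{n-1}+F_{n-2}+\dots+F_{n-k}$ for all $n\in\mathbb{Z}$; such a sequence is uniquely determined by its initial values $(F_0,\dots,F_{k-1})$. For $0\le j\le k-1$, $B^{(j)}=\{B^{(j)}_n\}_{n\in\mathbb{Z}}$ is the Fibonacci sequence of order $k$ with initial values $B^{(j)}_j=1$ and $B^{(j)}_n=0$ for $0\le n\le k-1$, $n\ne j$. Generalized binomial: for all integers $n,i$, $\left\langle \binom{n}{i}\right\rangle = \frac{n(n-1)(n-2)\cdots(i+1)}{(n-i)!}$ if $n\ge i$ (the empty product being $1$ when $n=i$), and $\left\langle \binom{n}{i}\right\rangle=0$ if $n<i$. Equivalently, $\left\langle \binom{n}{i}\right\rangle=\binom{n}{i}$ if $n\ge i\ge 0$, $\left\langle \binom{n}{i}\right\rangle=(-1)^{i+n}\binom{-i-1}{-n-1}$ if $-1\ge n\ge i$, and $0$ otherwise. Sums over $i\in\mathbb{Z}$ are sums of their finitely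 many nonzero terms. *)

(* Defs.v *)
From mathcomp Require Import all_boot all_order all_algebra.
From mathcomp Require Import mathcomp_extra boolp classical_sets cardinality.
From mathcomp Require Import fsbigop.
From mathcomp Require Import zify.

Set Implicit Arguments.
Unset Strict Implicit.
Unset Printing Implicit Defensive.

Import Order.TTheory GRing.Theory Num.Theory.

Local Open Scope classical_set_scope.
Local Open Scope ring_scope.

(* Values are taken in an arbitrary number field type [R] (e.g. [rat], a real
   field or the complex numbers) so that quotients by factorials and powers of
   2 with negative exponents have their usual meaning. *)

Definition fibonacci (R : numFieldType) (k : nat) (F : int -> R) : Prop :=
  forall n : int, F n = \sum_(1 <= t < k.+1) F (n - t%:Z).

Definition fibonacci_basis (R : numFieldType) (k j : nat) (B : int -> R) :
  Prop :=
  fibonacci k B /\ forall m : nat, (m < k)%N -> B m%:Z = (m == j)%:R.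

(* The product n (n - 1) ... (i + 1) has n - i factors, hence the range of t. *)
Definition gbinom (R : numFieldType) (n i : int) : R :=
  if i <= n then
    (\prod_(0 <= t < `|n - i|%N) (n - t%:Z)%:~R) / (`|n - i|%N)`!%:R
  else 0.

Lemma gbinom_eq0 (R : numFieldType) (n i : int) : i < 0 -> 0 <= n ->
  gbinom R n i = 0.
Proof.
move=> i0 n0; rewrite /gbinom; case: ifP => // _.
have hn : (`|n| < `|n - i|)%N by lia.
rewrite big_mkord (bigD1 (Ordinal hn)) //= gez0_abs //.
by rewrite subrr mulr0z !mul0r.
Qed.

(* [\sum_(i \in A) f i] is 0 by convention when the support of f in A is
   infinite; the following rules this out for sums involving [gbinom]. *)
Lemma gbinom_finite_support (R : numFieldType) (k : nat) (m : int)
    (e f : int -> R) : (0 < k)%N ->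
  finite_set [set i : int | e i * gbinom R (m - i * k%:Z) (i - 1) * f i != 0].
Proof.
move=> k0; have [N defN] : exists N, N = (`|m| + 2)%N by exists (`|m| + 2)%N.
apply: (@sub_finite_set _ _
  [set` [seq t%:Z - N%:Z | t <- iota 0 (N + N + 1)]]); last exact: finite_seq.
move=> i /=; rewrite !mulf_eq0 !negb_or => /andP[/andP[_ gi] _].
have le_i : i - 1 <= m - i * k%:Z.
  by apply: contraNT gi; rewrite /gbinom => /negbTE->.
have sgn_i : (1 <= i) || (m - i * k%:Z < 0).
  apply: contraNT gi; rewrite negb_or -ltNge -leNgt => /andP[i1 h].
  by rewrite gbinom_eq0 // subr_lt0.
have i_bnd : (`|i| <= N)%N by case/orP: sgn_i => ?; nia.
apply/mapP; exists `|(i + N%:Z)%R|%N; first by rewrite mem_iota; lia.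
by lia.
Qed.

Section Existence.
Variables (R : numFieldType) (k j : nat).

Let fwd (W : nat -> R) (m : nat) : R :=
  if (m.+1 < k)%N then W m.+1 else \sum_(0 <= t < k) W t.

Let bwd (W : nat -> R) (m : nat) : R :=
  if m is m'.+1 then W m' else W k.-1 - \sum_(0 <= t < k.-1) W t.

Let W0 (m : nat) : R := (m == j)%:R.

Let win (n : int) : nat -> R :=
  match n with Posz p => iter p fwd W0 | Negz p => iter p.+1 bwd W0 end.

Let winS (n : int) m : (0 < k)%N -> (m < k)%N -> win (n + 1) m = fwd (win n) m.
Proof.
move=> k0 mk; have bwdK W : W m = fwd (bwd W) m.
  rewrite /fwd /=; case: ifP => // mk'.
  have -> : m = k.-1 by lia.
  by rewrite -[in RHS](prednK k0) big_nat_recl //= subrK.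
case: n => p; first by have -> : Posz p + 1 = Posz p.+1 by lia.
case: p => [|p]; first exact: bwdK.
have -> : Negz p.+1 + 1 = Negz p by rewrite !NegzE; lia.
exact: bwdK.
Qed.

Let winE (n : int) m : (m < k)%N -> win n m = win (n + m%:Z) 0.
Proof.
elim: m n => [|m IH] n mk; first by rewrite addr0.
have -> : n + m.+1%:Z = (n + 1) + m%:Z by lia.
by rewrite -IH ?winS /fwd ?mk //; lia.
Qed.

Lemma fibonacci_basis_exists : (0 < k)%N ->
  exists B : int -> R, fibonacci_basis k j B.
Proof.
move=> k0; exists (win^~ 0%N); split=> [n|m mk]; last first.
  by have := @winE 0 m mk; rewrite add0r => <-.
have -> : n = (n - k%:Z + 1) + k.-1%:Z by lia.
rewrite -winE ?winS /fwd; [|lia..].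
rewrite prednK // ltnn.
rewrite big_add1 /= [RHS]big_nat_rev /= !big_nat; apply: eq_bigr => t /andP[_ tk].
rewrite winE //; congr (win _ _); lia.
Qed.

End Existence.

Lemma fibonacci_basis_unique (R : numFieldType) (k j : nat)
    (B C : int -> R) : (0 < k)%N ->
  fibonacci_basis k j B -> fibonacci_basis k j C -> B =1 C.
Proof.
move=> k0 [fB iB] [fC iC].
have H (p m : nat) : (m < k)%N ->
    B (p%:Z + m%:Z) = C (p%:Z + m%:Z) /\ B (m%:Z - p%:Z) = C (m%:Z - p%:Z).
  elim: p m => [|p IH] m mk; first by rewrite add0r subr0 iB // iC.
  split.
    have [mk'|mk'] := ltnP m.+1 k.
      have -> : p.+1%:Z + m%:Z = p%:Z + m.+1%:Z by lia.
      by case: (IH _ mk').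
    rewrite fB fC !big_nat; apply: eq_bigr => t /andP[t1 tk].
    have -> : p.+1%:Z + m%:Z - t%:Z = p%:Z + (m.+1 - t)%:Z by lia.
    by case: (IH (m.+1 - t)%N); [lia|].
  case: m mk => [_|m mk]; last first.
    have -> : m.+1%:Z - p.+1%:Z = m%:Z - p%:Z by lia.
    by case: (IH m (ltnW mk)).
  have {}IH (t : nat) : (t < k)%N -> B (t%:Z - p%:Z) = C (t%:Z - p%:Z).
    by case/IH.
  have := IH k.-1; rewrite prednK // => /(_ (leqnn _)).
  rewrite fB fC -{1 3}(prednK k0) !(big_nat_recr k.-1.+1) //=.
  have -> : \sum_(1 <= t < k.-1.+1) B (k.-1%:Z - p%:Z - t%:Z) =
            \sum_(1 <= t < k.-1.+1) C (k.-1%:Z - p%:Z - t%:Z).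
    rewrite !big_nat; apply: eq_bigr => t /andP[t1 tk].
    have -> : k.-1%:Z - p%:Z - t%:Z = (k.-1 - t)%:Z - p%:Z by lia.
    by apply: IH; lia.
  move/addrI; have -> : k.-1%:Z - p%:Z - k.-1.+1%:Z = 0%:Z - p.+1%:Z by lia.
  by [].
move=> n; case: n => p.
  by have [+ _] := H p 0%N k0; rewrite addr0.
by have [_] := H p.+1 0%N k0; rewrite sub0r NegzE.
Qed.

(* Main.v *)
(* Put S(n) = \sum_i (-1)^i <n - ik, i - 1> 2^(n + 1 - i(k + 1)), so that the
   claim reads B n = S(n - j - 1) - S(n).  Pascal's rule, which holds for
   [gbinom] without exception, gives S(n + 1) = 2 S(n) - S(n - k).  Hence
   S(n) - (S(n - 1) + ... + S(n - k)) does not depend on n, so it cancels in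
   the difference of two shifts of S, which is thus a Fibonacci sequence of
   order k.  Finally S(n) = [n = -1] for -k <= n < k, because in this range
   i = 0 and n = -1 give the only nonzero term. *)

Require Import Defs.
From mathcomp Require Import all_boot all_order all_algebra.
From mathcomp Require Import mathcomp_extra boolp classical_sets cardinality.
From mathcomp Require Import fsbigop.
From mathcomp Require Import ring zify.

Import Order.TTheory GRing.Theory Num.Theory.

Local Open Scope classical_set_scope.
Local Open Scope ring_scope.

(** [fsbig_split] asks for a finite index set, so all three sums are cut down to the union of the
    two supports, off which both functions equal [idx]. *)
Lemma fsbigT_split {T : choiceType} {R : eqType} {idx : R}
    (op : Monoid.com_law idx) (f g : T -> R) :
  finite_set [set i | f i != idx] -> finite_set [set i | g i != idx] ->
  \big[op/idx]_(i \in [set: T]) op (f i) (g i) =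
  op (\big[op/idx]_(i \in [set: T]) f i) (\big[op/idx]_(i \in [set: T]) g i).
Proof.
move=> finf fing; pose D := [set i | f i != idx] `|` [set i | g i != idx].
have DN i : ([set: T] `\` D) i -> f i = idx /\ g i = idx.
  case=> _ /= nD; split; apply/eqP; apply/negPn/negP => h; apply: nD.
    by left.
  by right.
have widen h : (forall i, ([set: T] `\` D) i -> h i = idx) ->
    \big[op/idx]_(i \in [set: T]) h i = \big[op/idx]_(i \in D) h i.
  by move=> hD; apply/esym/fsbig_widen.
rewrite !widen; first by rewrite fsbig_split // finite_setU.
- by move=> i /DN[].
- by move=> i /DN[].
- by move=> i /DN[-> ->]; rewrite Monoid.mul1m.
Qed.

Section FibonacciBinomial.
Variables (R : numFieldType) (k : nat).
Implicit Types n i : int.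

Lemma gbinom_small n i : n < i -> gbinom R n i = 0.
Proof. by rewrite /gbinom ltNge => /negbTE->. Qed.

Lemma gbinomnn n : gbinom R n n = 1.
Proof. by rewrite /gbinom lexx subrr big_geq // fact0 divr1. Qed.

(** For [i <= n], put [d = n - i] and factor out the product of the [d] factors of [gbinom R n i];
    what remains is [n + 1 = (n - d) + (d + 1)]. For [n + 1 = i] the rule reads 1 = 0 + 1. *)
Lemma gbinomS n i : gbinom R (n + 1) i = gbinom R n i + gbinom R n (i - 1).
Proof.
have [lt_ni|lt_in|<-] := ltgtP (n + 1) i.
- by rewrite !gbinom_small ?addr0 //; lia.
- have [d dE] : exists d : nat, n = i + d%:Z by exists `|n - i|%N; lia.
  rewrite /gbinom !ifT; [|lia..].
  have -> : `|(n + 1 - i)%R|%N = d.+1 by lia.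
  have -> : `|(n - i)%R|%N = d by lia.
  have -> : `|(n - (i - 1))%R|%N = d.+1 by lia.
  rewrite big_nat_recl // big_nat_recr //=.
  have E (t : nat) : n + 1 - t.+1%:Z = n - t%:Z by lia.
  under eq_bigr do rewrite E.
  have d0 : (d.+1%:R : R) != 0 by rewrite pnatr_eq0.
  have f0 : (d`!%:R : R) != 0 by rewrite pnatr_eq0 -lt0n fact_gt0.
  set P := \prod_(_ <= _ < _) _.
  have -> : n + 1 - 0%:Z = (n - d%:Z) + d.+1%:Z by lia.
  rewrite factS natrM intrD -pmulrn.
  by field; rewrite f0 nat1r.
- by rewrite addrK !gbinomnn gbinom_small ?add0r //; lia.
Qed.

Definition fibsum n : R :=
  \sum_(i \in [set: int])
    ((-1) ^ i * gbinom R (n - i * k%:Z) (i - 1) * 2 ^ (n + 1 - i * (k%:Z + 1))).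

Lemma fibsumS n : (0 < k)%N ->
  fibsum (n + 1) = 2 * fibsum n - fibsum (n - k%:Z).
Proof.
move=> k0; have two0 : (2 : R) != 0 by rewrite pnatr_eq0.
pose a n i : R :=
  (-1) ^ i * gbinom R (n - i * k%:Z) (i - 1) * 2 ^ (n + 1 - i * (k%:Z + 1)).
have afin m : finite_set [set i | a m i != 0] by exact: gbinom_finite_support.
(* The second Pascal term, with lower entry [i - 2], is the term of index [i - 1] in the sum at
   [n - k], because [n - i * k = (n - k) - (i - 1) * k]; the index shift flips the sign. *)
have aS i : a (n + 1) i = 2 * a n i + - 1 * a (n - k%:Z) (i - 1).
  rewrite /a.
  have -> : n + 1 - i * k%:Z = (n - i * k%:Z) + 1 by lia.
  rewrite gbinomS.
  have -> : n - k%:Z - (i - 1) * k%:Z = n - i * k%:Z by lia.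
  have -> : n - k%:Z + 1 - (i - 1) * (k%:Z + 1) =
            (n + 1 - i * (k%:Z + 1)) + 1 by lia.
  have -> : n + 1 + 1 - i * (k%:Z + 1) = (n + 1 - i * (k%:Z + 1)) + 1 by lia.
  rewrite [2 ^ (_ + 1)]expfzDr // expr1z.
  have -> : (-1 : R) ^ i = - (-1) ^ (i - 1).
    by rewrite -{1}(subrK 1 i) expfzDr ?oppr_eq0 ?oner_eq0 // expr1z mulrN1.
  ring.
have shift_bij : bijective (fun i : int => i - 1).
  by exists (fun i => i + 1) => i; rewrite ?subrK ?addrK.
have mulfin (c : R) (f : int -> R) : finite_set [set i | f i != 0] ->
    finite_set [set i | c * f i != 0].
  by apply: sub_finite_set => i; rewrite /= mulf_eq0 negb_or => /andP[].
have shiftfin : finite_set [set i | a (n - k%:Z) (i - 1) != 0].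
  have -> : [set i | a (n - k%:Z) (i - 1) != 0] =
            (fun i => i + 1) @` [set i | a (n - k%:Z) i != 0].
    apply/seteqP; split=> [i /= ai|i /= [i' ai' <-]]; last by rewrite addrK.
    by exists (i - 1); rewrite ?subrK.
  exact: finite_image.
have -> : fibsum (n + 1) =
    \sum_(i \in [set: int]) (2 * a n i + - 1 * a (n - k%:Z) (i - 1)).
  by apply: eq_fsbigr => i _; exact: aS.
rewrite (fsbigT_split +%R) /=; [|exact: mulfin..].
rewrite -!mulr_fsumr mulN1r.
by congr (_ - _); rewrite [RHS](reindex_fsbigT _ _ shift_bij).
Qed.

(** The range contains both [m] and [m - j - 1] whenever [m] and [j] lie in [[0, k)]. *)
Lemma fibsum_initial n : - k%:Z <= n < k%:Z -> fibsum n = (n == -1)%:R.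
Proof.
move=> /andP[nk kn]; rewrite /fibsum.
rewrite -(@fsbig_widen _ _ _ _ [set 0 : int]) //; last first.
  (* If [i >= 1], then [n - i * k < 0 <= i - 1]. If [i <= -1], then [n - i * k >= n + k >= 0] while
     [i - 1 < 0], so the numerator contains the factor 0. *)
  move=> i [_ /= /eqP i0]; have [hi|hi] := ltP (n - i * k%:Z) (i - 1).
    by rewrite gbinom_small // mulr0 mul0r.
  by rewrite gbinom_eq0 ?mulr0 ?mul0r //; nia.
rewrite fsbig_set1 !mul0r !subr0 sub0r expr0z mul1r.
have [->|n1] := eqVneq n (-1); first by rewrite gbinomnn mul1r.
have [hn|hn] := ltP n (-1); first by rewrite gbinom_small ?mul0r.
by rewrite gbinom_eq0 ?mul0r //; lia.
Qed.

Lemma fibsum_window n : (0 < k)%N ->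
  fibsum n - \sum_(1 <= t < k.+1) fibsum (n - t%:Z) =
  fibsum 0 - \sum_(1 <= t < k.+1) fibsum (0 - t%:Z).
Proof.
move=> k0; pose D n := fibsum n - \sum_(1 <= t < k.+1) fibsum (n - t%:Z).
(* From [m] to [m + 1] the window gains [fibsum m] and loses [fibsum (m - k)], which is exactly the
   change of the leading term by [fibsumS]. *)
have DS m : D (m + 1) = D m.
  rewrite /D fibsumS // [in RHS]big_nat_recr // [in LHS]big_ltn // [in LHS]big_add1 /=.
  have E (t : nat) : m + 1 - t.+1%:Z = m - t%:Z by lia.
  under eq_bigr do rewrite E.
  rewrite E subr0; ring.
rewrite -/(D n) -/(D 0); elim/int_rec: n => [//|n IH|n IH].
  by rewrite -IH -(DS n); congr D; lia.
by rewrite -IH -(DS (- n.+1%:Z)); congr D; lia.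
Qed.

End FibonacciBinomial.

Theorem theorem7 (R : numFieldType) (k j : nat) (hk : (2 <= k)%N)
    (hj : (j <= k - 1)%N) (B : int -> R) (hB : fibonacci_basis k j B) (n : int) :
  B n =
    - (\sum_(i \in [set: int])
        ((-1) ^ i * gbinom R (n - i * k%:Z) (i - 1)
         * 2 ^ (n + 1 - i * (k%:Z + 1))))
    + \sum_(i \in [set: int])
        ((-1) ^ i * gbinom R (n - j%:Z - 1 - i * k%:Z) (i - 1)
         * 2 ^ (n - j%:Z - i * (k%:Z + 1))).
Proof.
have k0 : (0 < k)%N by lia.
pose C m := - fibsum R k m + fibsum R k (m - j%:Z - 1).
suff hC : fibonacci_basis k j C.
  rewrite (fibonacci_basis_unique k0 hB hC) /C /fibsum; congr (_ + _).
  by apply: eq_fsbigr => i _; rewrite subrK.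
split=> [m|m mk].
  rewrite /C big_split sumrN /=.
  (* Both shifts have the same defect from the recurrence, so it cancels in [C]. *)
  have := fibsum_window R k (m - j%:Z - 1) k0.
  rewrite -(fibsum_window R k m k0) => /eqP.
  rewrite subr_eq => /eqP->.
  have E (t : nat) : m - t%:Z - j%:Z - 1 = m - j%:Z - 1 - t%:Z by lia.
  under [X in _ = _ + X]eq_bigr do rewrite E.
  ring.
rewrite /C !fibsum_initial; [|lia..].
(* As [m >= 0], the first summand of [C] vanishes; the second is 1 exactly when [m - j - 1 = -1]. *)
have [->|mj] := eqVneq m j.
  have -> : (j%:Z == -1) = false by lia.
  by have -> : (j%:Z - j%:Z - 1 == -1); [lia|rewrite oppr0 add0r].
have -> : (m%:Z == -1) = false by lia.
by have -> : (m%:Z - j%:Z - 1 == -1) = false; [lia|rewrite oppr0 add0r].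
Qed.
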